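(* Let $f:\mathbb{R}^n\to\mathbb{R}$ and suppose that Assumptions A1–A4 listed in the context hold. Run the algorithm InexactLMBM (described in the context) with $\varepsilon=0$ from a starting point $x_1\in\mathbb{R}^n$. If the algorithm terminates at the $k$th iteration (i.e. the stopping test in Step 4 is satisfied at iteration $k$), then the point $x_k$ is approximately stationary for $f$, that is, $\mathbf 0\in\partial f(x_k)+B_{\bar r}$.
   Context: Notation. $\|\cdot\|$ is the Euclidean norm on $\mathbb{R}^n$; $B_r=\{e\in\mathbb{R}^n:\|e\|\le r\}$ for $r\ge 0$ (so $B_0=\{\mathbf 0\}$); $\partial f(x)$ is the Clarke subdifferential, $\partial f(x)=\operatorname{conv}\{\lim_i\nabla f(x_i): x_i\to x,\ \nabla f(x_i)\text{ exists}\}$. Inexact oracle. At each point $y_k$ generated by the algorithm one receives $f_k=f(y_k)-q_k$ with $q_k\in\mathbb{R}$ an unknown error, and a vector $\xi_k\in\partial f(y_k)+B_{r_k}$ with $r_k\ge0$ an unknown error. If $y_k=x_k$ (the current basic point), then $f_k=\hat f_k$. Assumptions. A1: $f$ is locally Lipschitz continuous (Lipschitz on every bounded subset of $\mathbb{R}^n$). A2: for each starting point $x_1\in\mathbb{R}^n$ the level set $\{x: f(x)\le f(x_1)\}$ is bounded. A3: the sequence $\{\eta_k\}$ of convexification parameters (defined below) is bounded. A4: there are constants $\bar q,\bar r\ge0$ with $|q_k|\le\bar q$ and $0\le r_k\le\bar r$ for all $k$. A point $x$ is approximately stationary for $f$ if $\mathbf 0\in\partial f(x)+B_{\bar r}$.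 Linearization error, convexification parameter, modified subgradient, modified locality measure. With a fixed $\gamma>0$: $\alpha_k=\hat f_k-f_k-\xi_k^\top(x_k-y_k)$; $\eta_k=\max\{-2\alpha_k/\|y_k-x_k\|^2,0\}+\gamma$ if $x_k\ne y_k$, and $\eta_k=\gamma$ if $x_k=y_k$; $\xi_k^{mod}=\xi_k+\eta_k(y_k-x_k)$; $\beta_k=\alpha_k+\frac{\eta_k}{2}\|y_k-x_k\|^2$. (If $x_k=y_k$, then $\xi_k^{mod}=\xi_k$ and $\beta_k=0$.) Algorithm InexactLMBM. Parameters: $\varepsilon\ge0$, $\varepsilon_L\in(0,1/2)$, $\gamma>0$, $t_{min}\in(0,1]$, $C>0$, $\varrho\in(0,1/2)$, and an integer $\hat m_c\ge3$. Step 0: choose $x_1\in\mathbb{R}^n$, $y_1=x_1$; obtain $f_1,\xi_1$; set $\hat f_1=f_1$, $\beta_1=0$, $\xi_1^{mod}=\xi_1$, $i_C=0$, $D_1=I$, $k=1$. Step 1 (serious step initialization): $\tilde\xi_k=\xi_k$, $\tilde\beta_k=0$, $i_{CN}=0$, $m=k$. Step 2: $d_k=-D_k\tilde\xi_k$, where $D_k$ is obtained by the L-BFGS update if $m=k$ and by the L-SR1 update otherwise (for $k=1$, $d_1=-\xi_1$). Step 3 (correction): if $-\tilde\xi_k^\top d_k<\varrho\,\tilde\xi_k^\top\tilde\xi_k$ or $i_{CN}=1$, set $d_k\leftarrow d_k-\varrho\tilde\xi_k$ (i.e. $D_k\leftarrow D_k+\varrho I$) and $i_C=1$; otherwise $i_C=0$.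 If $i_C=1$ and $m<k$, set $i_{CN}=1$. Step 4 (stopping test): $w_k=-\tilde\xi_k^\top d_k+2\tilde\beta_k$; if $w_k\le\varepsilon$, stop with $x_k$ as the final solution. Step 5: choose a stepsize $t_k\in[t_{min},1]$ (computed from previous bundle elements). If $\|d_k\|>C$, replace $d_k$ by $\frac{C}{\|d_k\|}d_k$. Set $y_{k+1}=x_k+t_kd_k$, obtain $f_{k+1},\xi_{k+1}$, set $s_k=y_{k+1}-x_k=t_kd_k$. Step 6 (serious step): if $f_{k+1}-\hat f_k\le-\varepsilon_Lt_kw_k$, set $x_{k+1}=y_{k+1}$, $\beta_{k+1}=0$, $u_k=\xi_{k+1}-\xi_m$, $\hat f_{k+1}=f_{k+1}$, $k\leftarrow k+1$ and go to Step 1. Step 7 (null step): otherwise set $x_{k+1}=x_k$, $\hat f_{k+1}=\hat f_k$, compute $\alpha_{k+1},\eta_{k+1}$ by the formulas above, $\xi_{k+1}^{mod}=\xi_{k+1}+\eta_{k+1}s_k$, $\beta_{k+1}=\alpha_{k+1}+\frac{\eta_{k+1}}{2}\|s_k\|^2$, $u_k=\xi_{k+1}^{mod}-\xi_m$. Step 8 (aggregation): let $(\lambda_1^k,\lambda_2^k,\lambda_3^k)$ minimize, over $\lambda_i\ge0$, $\lambda_1+\lambda_2+\lambda_3=1$, the function $\varphi(\lambda)=v(\lambda)^\top D_kv(\lambda)+2(\lambda_2\beta_{k+1}+\lambda_3\tilde\beta_k)$, $v(\lambda)=\lambda_1\xi_m+\lambda_2\xi_{k+1}^{mod}+\lambda_3\tilde\xi_k$,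 where $D_k$ is the matrix of Step 2, with $\varrho I$ added if $i_C=1$. Set $\tilde\xi_{k+1}=\lambda_1^k\xi_m+\lambda_2^k\xi_{k+1}^{mod}+\lambda_3^k\tilde\xi_k$, $\tilde\beta_{k+1}=\lambda_2^k\beta_{k+1}+\lambda_3^k\tilde\beta_k$, $k\leftarrow k+1$, go to Step 2. Matrix updates. With $\hat m_k=\min\{k-1,\hat m_c\}$, $S_k=[s_{k-\hat m_k}\cdots s_{k-1}]$, $U_k=[u_{k-\hat m_k}\cdots u_{k-1}]$, $R_k$ the upper triangular matrix with $(R_k)_{ij}=s_{k-\hat m_k-1+i}^\top u_{k-\hat m_k-1+j}$ for $i\le j$ (zero otherwise), $C_k=\operatorname{diag}(s_{k-\hat m_k}^\top u_{k-\hat m_k},\dots,s_{k-1}^\top u_{k-1})$: L-BFGS: $D_k=\vartheta_kI+[S_k\ \ \vartheta_kU_k]\begin{bmatrix}(R_k^{-1})^\top(C_k+\vartheta_kU_k^\top U_k)R_k^{-1}&-(R_k^{-1})^\top\\-R_k^{-1}&0\end{bmatrix}\begin{bmatrix}S_k^\top\\\vartheta_kU_k^\top\end{bmatrix}$ with $\vartheta_k=\frac{u_{k-1}^\top s_{k-1}}{u_{k-1}^\top u_{k-1}}$; L-SR1: $D_k=\vartheta_kI-(\vartheta_kU_k-S_k)(\vartheta_kU_k^\top U_k-R_k-R_k^\top+C_k)^{-1}(\vartheta_kU_k-S_k)^\top$ with $\vartheta_k=1$. The update from $D_k$ to $D_{k+1}$ is skipped ($D_{k+1}=D_k$) if $-d_k^\top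 u_k-\tilde\xi_k^\top s_k<0$ fails. All matrices $D_k$ used by the algorithm are symmetric positive definite. *)

(* Defs.v *)
From HB Require Import structures.
From mathcomp Require Import all_boot all_order all_algebra.
From mathcomp Require Import all_classical all_reals all_analysis.

Set Implicit Arguments.
Unset Strict Implicit.
Unset Printing Implicit Defensive.

Import Order.TTheory GRing.Theory Num.Theory.
Import numFieldNormedType.Exports.

Local Open Scope classical_set_scope.
Local Open Scope ring_scope.

(* The topology (convergence, boundedness, differentiability) of 'cV[R]_n is
   the library's one, which is induced by the max norm and is therefore the
   Euclidean topology; everything metric is stated with [enorm]. *)

Section Euclidean.
Variables (R : realType) (n : nat).
Implicit Types u v : 'cV[R]_n.

Definition dotv u v : R := (u^T *m v) ord0 ord0.

Definition enorm v : R := Num.sqrt (dotv v v).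

Definition eball (r : R) : set 'cV[R]_n := [set e | enorm e <= r].

Definition set_add (A B : set 'cV[R]_n) : set 'cV[R]_n :=
  [set z | exists a b, [/\ A a, B b & z = a + b]].

Definition conv_hull (A : set 'cV[R]_n) : set 'cV[R]_n :=
  [set z | exists (p : nat) (c : 'I_p -> R) (a : 'I_p -> 'cV[R]_n),
     [/\ forall i, 0 <= c i, \sum_i c i = 1, forall i, A (a i)
       & z = \sum_i c i *: a i]].

Definition spd (D : 'M[R]_n) : Prop :=
  D^T = D /\ forall v, v != 0 -> 0 < dotv v (D *m v).

End Euclidean.

Section Clarke.
Variables (R : realType) (n : nat) (f : 'cV[R]_n -> R).

Definition is_gradient (x g : 'cV[R]_n) : Prop :=
  differentiable f x /\ forall v, 'd f x v = dotv g v.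

Definition limiting_gradients (x : 'cV[R]_n) : set 'cV[R]_n :=
  [set g | exists (xs gs : nat -> 'cV[R]_n),
     [/\ xs @ \oo --> x, forall i, is_gradient (xs i) (gs i)
       & gs @ \oo --> g]].

Definition clarke (x : 'cV[R]_n) : set 'cV[R]_n :=
  conv_hull (limiting_gradients x).

Definition lipschitz_on_bounded : Prop :=
  forall B : set 'cV[R]_n, bounded_set B ->
    exists L : R, forall x y, B x -> B y -> `|f x - f y| <= L * enorm (x - y).

Definition bounded_level_sets : Prop :=
  forall x1 : 'cV[R]_n, bounded_set [set x | f x <= f x1].

Definition approx_stationary (rbar : R) (x : 'cV[R]_n) : Prop :=
  set_add (clarke x) (eball rbar) 0.

End Clarke.

Section LimitedMemory.
Variables (R : realType) (n mh : nat) (k : nat) (s u : nat -> 'cV[R]_n).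

(* [mh] pairs are stored, the columns being numbered from 0: column j holds the
   pair of index k - mh + j, and [mh < k]. *)
Definition hist (v : nat -> 'cV[R]_n) : 'M[R]_(n, mh) :=
  \matrix_(i, j) v (k - mh + j)%N i ord0.

Definition lm_R : 'M[R]_mh :=
  \matrix_(i, j) (if (i <= j)%N then dotv (s (k - mh + i)%N) (u (k - mh + j)%N)
                  else 0).

Definition lm_C : 'M[R]_mh :=
  diag_mx (\row_j dotv (s (k - mh + j)%N) (u (k - mh + j)%N)).

Definition lbfgs : 'M[R]_n :=
  let th := dotv (u k.-1) (s k.-1) / dotv (u k.-1) (u k.-1) in
  let S := hist s in
  let U := hist u in
  let Ri := invmx lm_R in
  th%:M +
  row_mx S (th *: U) *m
  block_mx (Ri^T *m (lm_C + th *: (U^T *m U)) *m Ri) (- Ri^T) (- Ri) 0 *m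
  col_mx S^T (th *: U^T).

Definition lsr1 : 'M[R]_n :=
  let th : R := 1 in
  let S := hist s in
  let U := hist u in
  th%:M -
  (th *: U - S) *m
  invmx (th *: (U^T *m U) - lm_R - lm_R^T + lm_C) *m
  (th *: U - S)^T.

End LimitedMemory.

Record params (R : realType) := Params {
  p_eps : R;
  p_epsL : R;
  p_gamma : R;
  p_tmin : R;
  p_C : R;
  p_rho : R;
  p_mc : nat }.

Definition valid_params (R : realType) (P : params R) : Prop :=
  [/\ 0 <= p_eps P, 0 < p_epsL P < 2^-1, 0 < p_gamma P & 0 < p_tmin P <= 1] /\
  [/\ 0 < p_C P, 0 < p_rho P < 2^-1 & (3 <= p_mc P)%N].

(* Values held by the variables of the algorithm, indexed by the iteration
   number k >= 1 (index 0 is never read).  [seq_D k], [seq_m k], [seq_iCN k], [seq_txi k],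
   [seq_tbeta k] are the values of D_k, m, i_CN and the aggregates on entry to the
   correction step of iteration k; in particular [seq_D k] is the matrix without
   the correction rho I. *)
Record trace (R : realType) (n : nat) := Trace {
  seq_x : nat -> 'cV[R]_n;
  seq_y : nat -> 'cV[R]_n;
  seq_f : nat -> R;
  seq_fhat : nat -> R;
  seq_xi : nat -> 'cV[R]_n;
  seq_q : nat -> R;
  seq_r : nat -> R;
  seq_m : nat -> nat;
  seq_D : nat -> 'M[R]_n;
  seq_iCN : nat -> bool;
  seq_txi : nat -> 'cV[R]_n;
  seq_tbeta : nat -> R;
  seq_t : nat -> R;
  seq_lam : nat -> 'I_3 -> R }.

Section Algorithm.
Variables (R : realType) (n : nat) (f : 'cV[R]_n -> R).
Variables (P : params R) (T : trace R n).
Implicit Type k : nat.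

Let x := seq_x T.
Let y := seq_y T.
Let fv := seq_f T.
Let fhat := seq_fhat T.
Let xi := seq_xi T.
Let m := seq_m T.
Let txi := seq_txi T.
Let tbeta := seq_tbeta T.
Let t := seq_t T.
Let lam := seq_lam T.

Definition lin_err k : R := fhat k - fv k - dotv (xi k) (x k - y k).

(* These formulas also cover the serious steps (x_k = y_k, f^_k = f_k), where they
   give alpha_k = beta_k = 0, eta_k = gamma and xi_k^mod = xi_k. *)
Definition cvx_param k : R :=
  if x k == y k then p_gamma P
  else Num.max (- 2 * lin_err k / enorm (y k - x k) ^+ 2) 0 + p_gamma P.

Definition xi_mod k : 'cV[R]_n := xi k + cvx_param k *: (y k - x k).

Definition loc_meas k : R := lin_err k + cvx_param k / 2 * enorm (y k - x k) ^+ 2.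

Definition dir0 k : 'cV[R]_n := - (seq_D T k *m txi k).

Definition i_C k : bool :=
  (- dotv (txi k) (dir0 k) < p_rho P * dotv (txi k) (txi k)) || seq_iCN T k.

Definition dir_corr k : 'cV[R]_n :=
  if i_C k then dir0 k - p_rho P *: txi k else dir0 k.

Definition D_corr k : 'M[R]_n :=
  if i_C k then seq_D T k + (p_rho P)%:M else seq_D T k.

Definition crit_w k : R := - dotv (txi k) (dir_corr k) + 2 * tbeta k.

(* the direction after the truncation; w_k is computed before it *)
Definition dir k : 'cV[R]_n :=
  if p_C P < enorm (dir_corr k)
  then (p_C P / enorm (dir_corr k)) *: dir_corr k
  else dir_corr k.

Definition step_s k : 'cV[R]_n := y k.+1 - x k.

Definition serious k : bool := fv k.+1 - fhat k <= - p_epsL P * t k * crit_w k.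

Definition diff_u k : 'cV[R]_n :=
  if serious k then xi k.+1 - xi (m k) else xi_mod k.+1 - xi (m k).

Definition simplex3 (l : 'I_3 -> R) : Prop :=
  (forall i, 0 <= l i) /\ \sum_i l i = 1.

Definition i1 : 'I_3 := @Ordinal 3 0 isT.
Definition i2 : 'I_3 := @Ordinal 3 1 isT.
Definition i3 : 'I_3 := @Ordinal 3 2 isT.

Definition agg_xi k (l : 'I_3 -> R) : 'cV[R]_n :=
  l i1 *: xi (m k) + l i2 *: xi_mod k.+1 + l i3 *: txi k.

Definition agg_beta k (l : 'I_3 -> R) : R :=
  l i2 * loc_meas k.+1 + l i3 * tbeta k.

Definition agg_obj k (l : 'I_3 -> R) : R :=
  dotv (agg_xi k l) (D_corr k *m agg_xi k l) + 2 * agg_beta k l.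

Definition mhat k : nat := minn k.-1 (p_mc P).

Definition serious_step k : Prop :=
  [/\ x k.+1 = y k.+1, fhat k.+1 = fv k.+1 & m k.+1 = k.+1] /\
  [/\ txi k.+1 = xi k.+1, tbeta k.+1 = 0 & seq_iCN T k.+1 = false].

Definition null_step k : Prop :=
  [/\ x k.+1 = x k, fhat k.+1 = fhat k, m k.+1 = m k
    & seq_iCN T k.+1 = seq_iCN T k || (i_C k && (m k < k)%N)] /\
  [/\ simplex3 (lam k), forall l, simplex3 l -> agg_obj k (lam k) <= agg_obj k l,
      txi k.+1 = agg_xi k (lam k) & tbeta k.+1 = agg_beta k (lam k)].

(* When the update is skipped, D_{k+1} = D_k may be read with D_k before or
   after the correction; both are allowed.  Where a matrix to be inverted is
   singular the formulas have no meaning; the library's conventions apply, which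
   only admits additional runs. *)
Definition matrix_update k : Prop :=
  if - dotv (dir k) (diff_u k) - dotv (txi k) (step_s k) < 0 then
    seq_D T k.+1 = if m k.+1 == k.+1 then lbfgs (mhat k.+1) k.+1 step_s diff_u
                   else lsr1 (mhat k.+1) k.+1 step_s diff_u
  else seq_D T k.+1 = seq_D T k \/ seq_D T k.+1 = D_corr k.

Definition initialization (x1 : 'cV[R]_n) : Prop :=
  [/\ x 1%N = x1, y 1%N = x1, fhat 1%N = fv 1%N & seq_D T 1%N = 1%:M] /\
  [/\ m 1%N = 1%N, txi 1%N = xi 1%N, tbeta 1%N = 0 & seq_iCN T 1%N = false].

Definition oracle_answer k : Prop :=
  [/\ fv k = f (y k) - seq_q T k,
      0 <= seq_r T k,
      set_add (clarke f (y k)) (eball (seq_r T k)) (xi k)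
    & y k = x k -> fv k = fhat k].

Definition iteration k : Prop :=
  [/\ p_tmin P <= t k <= 1,
      y k.+1 = x k + t k *: dir k,
      if serious k then serious_step k else null_step k
    & matrix_update k].

(* [run_until x1 K]: iteration K is reached, none of the previous ones stopped. *)
Definition run_until (x1 : 'cV[R]_n) (K : nat) : Prop :=
  [/\ initialization x1,
      forall k, (1 <= k <= K)%N -> oracle_answer k,
      forall k, (1 <= k <= K)%N -> spd (seq_D T k)
    & forall k, (1 <= k < K)%N -> p_eps P < crit_w k /\ iteration k].

Definition terminates_at (x1 : 'cV[R]_n) (K : nat) : Prop :=
  [/\ (1 <= K)%N, run_until x1 K & crit_w K <= p_eps P].

(* A run stopping at K only generates the parameters of index at most K. *)
Definition bounded_eta (K : nat) : Prop :=
  exists M : R, forall k, (1 <= k <= K)%N -> `|cvx_param k| <= M.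

Definition bounded_errors (qbar rbar : R) (K : nat) : Prop :=
  [/\ 0 <= qbar, 0 <= rbar
    & forall k, (1 <= k <= K)%N -> `|seq_q T k| <= qbar /\ 0 <= seq_r T k <= rbar].

End Algorithm.

(* Main.v *)
(** Write [S_k] for the Clarke subdifferential at [x_k] enlarged by the ball of
    radius [rbar]; it is convex.  The locality measures satisfy
    [beta_j >= gamma / 2 * |y_j - x_j|^2], so the aggregate [tbeta_k], a convex
    combination of them, is nonnegative, and if it vanishes then every
    modified subgradient entering [txi_k] with a positive weight was computed at
    the point [x_k] itself, hence lies in [S_k]; so does [txi_k].  At termination
    [txi_k^T D_k txi_k + 2 tbeta_k <= 0] with [D_k] positive definite, which
    forces both [txi_k = 0] and [tbeta_k = 0]. *)
Require Import Defs.
From mathcomp Require Import all_boot all_order all_algebra.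
From mathcomp Require Import all_classical all_reals all_analysis.
From mathcomp Require Import ring lra.

Import Order.TTheory GRing.Theory Num.Theory.
Import numFieldNormedType.Exports.

Local Open Scope ring_scope.

Section EuclideanFacts.
Set Implicit Arguments.
Unset Strict Implicit.
Variables (R : realType) (n : nat).
Implicit Types (u v w : 'cV[R]_n) (A B : set 'cV[R]_n).

Lemma dotvE u v : dotv u v = \sum_i u i ord0 * v i ord0.
Proof. by rewrite /dotv mxE; apply: eq_bigr => i _; rewrite mxE. Qed.

Lemma dotv0r u : dotv u 0 = 0.
Proof. by rewrite /dotv mulmx0 mxE. Qed.

Lemma dotvDr u v w : dotv u (v + w) = dotv u v + dotv u w.
Proof. by rewrite /dotv mulmxDr mxE. Qed.

Lemma dotvNr u v : dotv u (- v) = - dotv u v.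
Proof. by rewrite /dotv mulmxN mxE. Qed.

Lemma dotvZr c u v : dotv u (c *: v) = c * dotv u v.
Proof. by rewrite /dotv -scalemxAr mxE. Qed.

Lemma dotvv_ge0 u : 0 <= dotv u u.
Proof. by rewrite dotvE; apply: sumr_ge0 => i _; rewrite -expr2 sqr_ge0. Qed.

Lemma dotvv_eq0 u : dotv u u = 0 -> u = 0.
Proof.
rewrite dotvE => /eqP; rewrite psumr_eq0; last first.
  by move=> i _; rewrite -expr2 sqr_ge0.
move=> /allP u0; apply/colP => i; rewrite mxE.
by have /(_ (mem_index_enum i)) := u0 i; rewrite /= mulf_eq0 orbb => /eqP.
Qed.

Lemma enorm_sqr u : enorm u ^+ 2 = dotv u u.
Proof. by rewrite sqr_sqrtr ?dotvv_ge0. Qed.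

Lemma enorm_leE u (r : R) : 0 <= r -> (enorm u <= r) = (dotv u u <= r ^+ 2).
Proof. by move=> r0; rewrite -enorm_sqr ler_sqr ?nnegrE ?sqrtr_ge0. Qed.

(* The defect is [a b |u - v|^2]. *)
Lemma dotvv_convex (a b : R) u v : 0 <= a -> 0 <= b -> a + b = 1 ->
  dotv (a *: u + b *: v) (a *: u + b *: v) <= a * dotv u u + b * dotv v v.
Proof.
move=> a0 b0 ab1; rewrite !dotvE !mulr_sumr -big_split; apply: ler_sum => i _.
rewrite !mxE /= -subr_ge0.
rewrite (_ : _ - _ = a * b * (u i ord0 - v i ord0) ^+ 2).
  by rewrite mulr_ge0 ?sqr_ge0 ?mulr_ge0.
have -> : b = 1 - a by lra.
by ring.
Qed.

Definition convex_vset A : Prop := forall (a b : R) u v,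
  0 <= a -> 0 <= b -> a + b = 1 -> A u -> A v -> A (a *: u + b *: v).

Lemma eball_convex (r : R) : 0 <= r -> convex_vset (eball r).
Proof.
move=> r0 a b u v a0 b0 ab1; rewrite /eball /= !enorm_leE// => ur vr.
apply: (le_trans (dotvv_convex u v a0 b0 ab1)).
by rewrite -[leRHS]mul1r -ab1 mulrDl lerD ?ler_wpM2l.
Qed.

(** Two finite combinations are concatenated, the weights of the first scaled by [a] and those of
    the second by [b]. *)
Lemma conv_hull_convex A : convex_vset (conv_hull A).
Proof.
move=> a b _ _ a0 b0 ab1 [p [c [z [c0 c1 Az ->]]]] [p' [c' [z' [c0' c1' Az' ->]]]].
exists (p + p')%N,
  (fun i : 'I_(p + p') => match fintype.split i with inl j => a * c j | inr j => b * c' j end),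
  (fun i : 'I_(p + p') => match fintype.split i with inl j => z j | inr j => z' j end); split.
- by move=> i; case: fintype.split => j; rewrite mulr_ge0.
- rewrite big_split_ord /=.
  (* Writing [lshift] as [unsplit (inl _)] lets [unsplitK] evaluate the case analysis on [split]. *)
  under eq_bigr do rewrite -[lshift _ _]/(unsplit (inl _)) unsplitK.
  under [X in _ + X]eq_bigr do rewrite -[rshift _ _]/(unsplit (inr _)) unsplitK.
  by rewrite -!mulr_sumr c1 c1' !mulr1.
- by move=> i; case: fintype.split.
- rewrite big_split_ord /=.
  under [X in _ = X + _]eq_bigr do
    rewrite -[lshift _ _]/(unsplit (inl _)) unsplitK -scalerA.
  under [X in _ = _ + X]eq_bigr do
    rewrite -[rshift _ _]/(unsplit (inr _)) unsplitK -scalerA.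
  by rewrite -!scaler_sumr.
Qed.

Lemma set_add_convex A B :
  convex_vset A -> convex_vset B -> convex_vset (set_add A B).
Proof.
move=> cA cB a b _ _ a0 b0 ab1 [u [e [Au Be ->]]] [v [g [Av Bg ->]]].
exists (a *: u + b *: v), (a *: e + b *: g); split.
- exact: cA.
- exact: cB.
- by rewrite !scalerDr addrACA.
Qed.

(** The first two points are merged into one of weight [a + b], after normalising their weights;
    this needs [a + b] nonzero, and otherwise only [w] remains. *)
Lemma convex_vset3 A (a b c : R) u v w : convex_vset A ->
  0 <= a -> 0 <= b -> 0 <= c -> a + b + c = 1 ->
  A u -> A v -> A w -> A (a *: u + b *: v + c *: w).
Proof.
move=> cA a0 b0 c0 abc Au Av Aw.
have [ab0|ab_neq0] := eqVneq (a + b) 0.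
  have [-> -> ->] : [/\ a = 0, b = 0 & c = 1] by split; lra.
  by rewrite !scale0r !add0r scale1r.
have -> : a *: u + b *: v = (a + b) *: ((a / (a + b)) *: u + (b / (a + b)) *: v).
  by rewrite scalerDr !scalerA ![_ * (_ / _)]mulrC !divfK.
apply: (cA) => //; first exact: addr_ge0.
by apply: cA; rewrite ?divr_ge0 ?addr_ge0// -mulrDl mulfV.
Qed.

(** Passes from the error of a single oracle call to the uniform bound [rbar]. *)
Lemma set_add_eballS A (r s : R) : r <= s ->
  (set_add A (eball r) `<=` set_add A (eball s))%classic.
Proof.
move=> rs _ [a [e [Aa er ->]]]; exists a, e; split => //.
exact: le_trans er rs.
Qed.

End EuclideanFacts.

Section Run.
Set Implicit Arguments.
Unset Strict Implicit.
Variables (R : realType) (n : nat) (f : 'cV[R]_n -> R).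
Variables (P : params R) (T : trace R n).
Hypothesis hP : valid_params P.

Let gamma_gt0 : 0 < p_gamma P. Proof. by case: hP => -[]. Qed.
Let rho_gt0 : 0 < p_rho P. Proof. by case: hP => _ [_ /andP[]]. Qed.

(** The convexification parameter exceeds [- 2 * al / N] by at least gamma, so the quadratic term
    compensates a negative linearization error and leaves a surplus of gamma / 2 times the squared
    distance. *)
Lemma loc_meas_ge k : oracle_answer f T k ->
  p_gamma P / 2 * enorm (seq_y T k - seq_x T k) ^+ 2 <= loc_meas P T k.
Proof.
case=> _ _ _ same; rewrite /loc_meas /cvx_param /lin_err.
have [xy|xy] := eqVneq (seq_x T k) (seq_y T k).
  (* Here the oracle returns [fhat], so the linearization error vanishes and both sides coincide. *)
  by rewrite same// xy !subrr dotv0r subr0 add0r.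
set N := enorm _ ^+ 2; set al := _ - _ - _.
have N_gt0 : 0 < N.
  rewrite /N enorm_sqr lt0r dotvv_ge0 andbT; apply: contra xy => /eqP/dotvv_eq0.
  by move/eqP; rewrite subr_eq0 eq_sym.
have : - 2 * al / N <= Num.max (- 2 * al / N) 0 by rewrite le_max lexx.
by rewrite ler_pdivrMr//; set M := Num.max _ _; lra.
Qed.

Lemma loc_meas_ge0 k : oracle_answer f T k -> 0 <= loc_meas P T k.
Proof.
move/loc_meas_ge; apply: le_trans.
by rewrite mulr_ge0 ?sqr_ge0// divr_ge0// ltW.
Qed.

Lemma loc_meas_eq0 k : oracle_answer f T k -> loc_meas P T k = 0 ->
  seq_x T k = seq_y T k.
Proof.
move=> /loc_meas_ge + b0; rewrite b0 enorm_sqr pmulr_rle0 ?divr_gt0// => le0.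
apply/esym/eqP; rewrite -subr_eq0; apply/eqP/dotvv_eq0.
by apply/le_anti; rewrite le0 dotvv_ge0.
Qed.

(** The correction can only add rho times the squared norm of [seq_txi T k], so positive
    definiteness of the uncorrected matrix can be used in the stopping test. *)
Lemma crit_w_ge k : dotv (seq_txi T k) (seq_D T k *m seq_txi T k)
  + 2 * seq_tbeta T k <= crit_w P T k.
Proof.
rewrite /crit_w /dir_corr /dir0 lerD2r; case: ifP => _; last by rewrite dotvNr opprK.
rewrite dotvDr !dotvNr dotvZr opprD !opprK lerDl.
by rewrite mulr_ge0 ?dotvv_ge0// ltW.
Qed.

Variables (qbar rbar : R) (x1 : 'cV[R]_n) (K : nat).
Hypothesis hA4 : bounded_errors T qbar rbar K.
Hypothesis hrun : run_until f P T x1 K.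

Let approx_subdiff (x : 'cV[R]_n) := set_add (clarke f x) (eball rbar).

Let approx_subdiff_convex x : convex_vset (approx_subdiff x).
Proof.
apply: set_add_convex; first exact: conv_hull_convex.
by apply: eball_convex; case: hA4.
Qed.

Let xi_approx_subdiff k : (1 <= k <= K)%N -> approx_subdiff (seq_y T k) (seq_xi T k).
Proof.
move=> kK; case: hA4 => _ _ /(_ k kK) [_ /andP[_ r_le]].
by case: hrun => _ /(_ k kK) [_ _ + _] _ _; apply: set_add_eballS.
Qed.

(** The first clause is carried along because [seq_xi T (seq_m T k)] enters the aggregate with no
    locality measure attached: a vanishing [seq_tbeta] says nothing about its weight. *)
Lemma aggregate_invariant k : (1 <= k <= K)%N ->
  [/\ approx_subdiff (seq_x T k) (seq_xi T (seq_m T k)),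
      0 <= seq_tbeta T k
    & seq_tbeta T k = 0 -> approx_subdiff (seq_x T k) (seq_txi T k)].
Proof.
case: (hrun) => -[[x1E y1E _ _] [m1 txi1 tb1 _]] oracle _ iter.
elim: k => // -[_ /= K1|k IH /= kK].
  have := @xi_approx_subdiff 1%N; rewrite y1E m1 txi1 tb1 x1E => /(_ K1) xi1.
  by split.
have {IH} [xim_in tb_ge0 txi_in] := IH (ltnW kK).
have [_ [_ _ + _]] := iter k.+1 kK.
case: ifP => _.
  (* A serious step resets the aggregate to the new subgradient, computed at the new basic point. *)
  move=> [[xE _ mE] [txiE tbE _]]; rewrite xE mE txiE tbE.
  by have := @xi_approx_subdiff k.+2 kK; split.
move=> [[xE _ mE _] [[lam_ge0 +] _ txiE tbE]].
rewrite !big_ord_recl big_ord0 addr0.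
rewrite (_ : ord0 = i1); last exact: val_inj.
rewrite (_ : lift i1 ord0 = i2); last exact: val_inj.
rewrite (_ : lift i1 (lift ord0 ord0) = i3); last exact: val_inj.
rewrite addrA => lam1.
have ora := oracle k.+2 kK.
have beta_ge0 := loc_meas_ge0 ora.
rewrite xE mE txiE tbE /agg_beta /agg_xi; split => //.
  by rewrite addr_ge0 ?mulr_ge0.
(* In a vanishing sum of nonnegative products, each term has zero weight or zero measure. *)
move/eqP; rewrite paddr_eq0 ?mulr_ge0// !mulf_eq0 => /andP[lam2 lam3].
have [v [-> v_in]] : exists v,
    seq_lam T k.+1 i2 *: xi_mod P T k.+2 = seq_lam T k.+1 i2 *: v /\
    approx_subdiff (seq_x T k.+1) v.
  have [l20|l2_neq0] := eqVneq (seq_lam T k.+1 i2) 0.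
    (* With zero weight any element of the set can stand in for the vector. *)
    by exists (seq_xi T (seq_m T k.+1)); rewrite l20 !scale0r.
  move: lam2; rewrite (negPf l2_neq0) => /eqP/(loc_meas_eq0 ora) xy.
  (* Zero measure means that the trial point is the basic point, so the modification term
     disappears. *)
  exists (seq_xi T k.+2); rewrite /xi_mod xy subrr scaler0 addr0; split => //.
  by rewrite -xE xy; apply: xi_approx_subdiff.
have [w [-> w_in]] : exists w,
    seq_lam T k.+1 i3 *: seq_txi T k.+1 = seq_lam T k.+1 i3 *: w /\
    approx_subdiff (seq_x T k.+1) w.
  have [l30|l3_neq0] := eqVneq (seq_lam T k.+1 i3) 0.
    by exists (seq_xi T (seq_m T k.+1)); rewrite l30 !scale0r.
  by exists (seq_txi T k.+1); split=> //; move: lam3; rewrite (negPf l3_neq0) => /eqP.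
by apply: convex_vset3.
Qed.

End Run.

Theorem theorem1 (R : realType) (n : nat) (f : 'cV[R]_n -> R)
    (P : params R) (T : trace R n) (qbar rbar : R) (x1 : 'cV[R]_n) (k : nat)
    (hP : valid_params P) (heps : p_eps P = 0)
    (hA1 : lipschitz_on_bounded f)
    (hA2 : bounded_level_sets f)
    (hA3 : bounded_eta P T k)
    (hA4 : bounded_errors T qbar rbar k)
    (hrun : terminates_at f P T x1 k) :
  approx_stationary f rbar (seq_x T k).
Proof.
case: hrun => k_ge1 run; rewrite heps => w_le0.
have kk : (1 <= k <= k)%N by rewrite k_ge1 leqnn.
have [_ tb_ge0 txi_in] := @aggregate_invariant _ _ _ _ _ hP _ _ _ _ hA4 run k kk.
have [_ _ /(_ k kk) [_ D_pos] _] := run.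
have q_le0 := le_trans (crit_w_ge T hP k) w_le0.
have txi0 : seq_txi T k = 0.
  (* A nonzero aggregate would make the quadratic form positive, against [q_le0] and [tb_ge0]. *)
  by apply/eqP; apply: contraT => /D_pos; lra.
move: q_le0; rewrite txi0 mulmx0 dotv0r => tb_le0.
by rewrite /approx_stationary -txi0; apply: txi_in; lra.
Qed.
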